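(* Let $N_r\ge N_t\ge 2$, let $\mathbf{H}\in\mathbb{C}^{N_r\times N_t}$, and let $E_s,N_0>0$. Form the augmented matrix $$\mathbf{H}_{\mathrm a}=\begin{bmatrix}\tfrac{1}{\sqrt{N_0}}\mathbf{H}\\ \tfrac{1}{\sqrt{E_s}}\mathbf{I}_{N_t}\end{bmatrix}\in\mathbb{C}^{(N_r+N_t)\times N_t}$$ and let $\mathbf{H}_{\mathrm a}=\mathbf{Q}_{\mathrm a}\mathbf{L}_{\mathrm a}$ be its thin QL decomposition. Fix $1\le\nu\le N_t-1$ and partition $$\mathbf{L}_{\mathrm a}=\begin{bmatrix}\mathbf{P}_{\mathrm a}&\mathbf{0}\\ \mathbf{R}_{\mathrm a}&\mathbf{S}_{\mathrm a}\end{bmatrix},$$ with $\mathbf{P}_{\mathrm a}\in\mathbb{C}^{\nu\times\nu}$ and $\mathbf{S}_{\mathrm a}\in\mathbb{C}^{(N_t-\nu)\times(N_t-\nu)}$. Define $$\boldsymbol{\Sigma}_{\mathrm a}=\operatorname{diag}(\mathbf{S}_{\mathrm a}^{-1}\mathbf{S}_{\mathrm a}^{-\dagger})^{-1/2},\qquad \mathbf{W}_{\mathrm{ap}}=\begin{bmatrix}\mathbf{I}_\nu&\mathbf{0}\\ \mathbf{0}&\boldsymbol{\Sigma}_{\mathrm a}\mathbf{S}_{\mathrm a}^{-1}\end{bmatrix},\qquad \mathbf{L}_{\mathrm{ap}}=\mathbf{W}_{\mathrm{ap}}\mathbf{L}_{\mathrm a}.$$ Let $\alpha=N_0/E_s$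 and $$\mathbf{W}_{\mathrm{MMSE}}=(\mathbf{H}^\dagger\mathbf{H}+\alpha\mathbf{I}_{N_t})^{-1}\mathbf{H}^\dagger,\qquad \mathbf{G}_{\mathrm{ap}}=\mathbf{L}_{\mathrm{ap}}^\dagger\mathbf{L}_{\mathrm{ap}},\qquad \mathbf{F}_{\mathrm{ap}}=\mathbf{W}_{\mathrm{MMSE}}^\dagger\mathbf{G}_{\mathrm{ap}}.$$ Define the detection model $$p_{\mathrm{ap}}(\mathbf{y}|\mathbf{x})=\exp\big(2\,\mathrm{Re}\{\mathbf{y}^\dagger\mathbf{F}_{\mathrm{ap}}\mathbf{x}\}-\mathbf{x}^\dagger\mathbf{G}_{\mathrm{ap}}\mathbf{x}+\tfrac{1}{E_s}\mathbf{x}^\dagger\mathbf{x}\big)$$ together with $$p_{\mathrm{ap}}(\mathbf{y})=\int_{\mathbb{C}^{N_t}}p_{\mathrm{ap}}(\mathbf{y}|\mathbf{x})\,p(\mathbf{x})\,d\mathbf{x}.$$ Assume $\mathbf{x}\sim\mathcal{CN}(\mathbf{0},E_s\mathbf{I}_{N_t})$ with density $p(\mathbf{x})$, and let $\mathbf{y}=\mathbf{H}\mathbf{x}+\mathbf{z}$ with $\mathbf{z}\sim\mathcal{CN}(\mathbf{0},N_0\mathbf{I}_{N_r})$ independent of $\mathbf{x}$. Then the lower bound on the achievable information rate of the augmented WLD detector, $$I_{\mathrm{LB}}^{\mathrm{AWLD}}=\mathbb{E}_{\mathbf{Y},\mathbf{X}}[\log p_{\mathrm{ap}}(\mathbf{y}|\mathbf{x})]-\mathbb{E}_{\mathbf{Y}}[\log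 p_{\mathrm{ap}}(\mathbf{y})],$$ in which the expectations are taken with respect to the true joint distribution of $(\mathbf{x},\mathbf{y})$, equals $$I_{\mathrm{LB}}^{\mathrm{AWLD}}=N_t\log E_s+\log\det\big(\mathbf{L}_{\mathrm{ap}}^\dagger\mathbf{L}_{\mathrm{ap}}\big).$$
   Context: The thin QL decomposition $\mathbf{H}_{\mathrm a}=\mathbf{Q}_{\mathrm a}\mathbf{L}_{\mathrm a}$ means that $\mathbf{Q}_{\mathrm a}\in\mathbb{C}^{(N_r+N_t)\times N_t}$ has orthonormal columns and $\mathbf{L}_{\mathrm a}\in\mathbb{C}^{N_t\times N_t}$ is lower triangular with real positive diagonal entries. Such a decomposition exists since $\mathbf{H}_{\mathrm a}$ always has full column rank. For a square matrix $\mathbf{A}$, $\operatorname{diag}(\mathbf{A})$ denotes the diagonal matrix having the same diagonal entries as $\mathbf{A}$. The superscript $\dagger$ denotes conjugate transpose, and $\log$ is the natural logarithm. *)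

(* Defs.v *)
From HB Require Import structures.
From mathcomp Require Import all_boot all_order all_algebra.
From mathcomp Require Import all_classical all_reals all_analysis.
From mathcomp Require Import complex.
Set Implicit Arguments. Unset Strict Implicit. Unset Printing Implicit Defensive.
Import Order.TTheory GRing.Theory Num.Theory.
Local Open Scope ring_scope.

Section AWLD.
Variable R : realType.
Local Notation C := (R[i]).

Definition RC (x : R) : C := Complex x 0.

Definition ctr (m n : nat) (A : 'M[C]_(m, n)) : 'M[C]_(n, m) :=
  \matrix_(i, j) (A j i)^*.

Definition sc (A : 'M[C]_1) : C := A ord0 ord0.

(* Lebesgue integral over C^n = R^(2n), written as the iterated Lebesgue
   integral over the real and imaginary parts of the coordinates
   (coincides with the integral over R^(2n) for integrable functions, by
   Fubini).  Coordinate n-1 is integrated outermost. *)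
Fixpoint iintC (n : nat) (f : (nat -> C) -> R) : R :=
  match n with
  | 0 => f (fun _ => 0)
  | n'.+1 =>
      Rintegral lebesgue_measure setT (fun a : R =>
      Rintegral lebesgue_measure setT (fun b : R =>
        iintC n' (fun g => f (fun k => if k == n' then Complex a b else g k))))
  end.

Definition intCn (n : nat) (F : 'cV[C]_n -> R) : R :=
  iintC n (fun g => F (\col_(i < n) g i)).

Definition cgauss (n : nat) (s : R) (v : 'cV[C]_n) : R :=
  (pi * s) ^- n * expR (- complex.Re (sc (ctr v *m v)) / s).

Definition augH (Nr Nt : nat) (N0 Es : R) (H : 'M[C]_(Nr, Nt))
  : 'M[C]_(Nr + Nt, Nt) :=
  col_mx (RC (Num.sqrt N0)^-1 *: H) (RC (Num.sqrt Es)^-1 *: 1%:M).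

Definition thinQL (m n : nat) (A : 'M[C]_(m, n)) (Q : 'M[C]_(m, n))
  (L : 'M[C]_n) : Prop :=
  [/\ ctr Q *m Q = 1%:M,
      (forall i j : 'I_n, (i < j)%N -> L i j = 0),
      (forall i : 'I_n, 0 < L i i) &
      A = Q *m L].

Definition mxdiag (n : nat) (A : 'M[C]_n) : 'M[C]_n := diag_mx (\row_i A i i).

Definition Sigma_a (m : nat) (S : 'M[C]_m) : 'M[C]_m :=
  let D := mxdiag (invmx S *m ctr (invmx S)) in
  diag_mx (\row_i (sqrtC (D i i))^-1).

Definition W_ap (nu mu : nat) (L : 'M[C]_(nu + mu)) : 'M[C]_(nu + mu) :=
  let S := drsubmx L in
  block_mx 1%:M 0 0 (Sigma_a S *m invmx S).

Definition L_ap (nu mu : nat) (L : 'M[C]_(nu + mu)) : 'M[C]_(nu + mu) :=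
  W_ap L *m L.

Definition W_MMSE (Nr Nt : nat) (alpha : R) (H : 'M[C]_(Nr, Nt))
  : 'M[C]_(Nt, Nr) :=
  invmx (ctr H *m H + (RC alpha)%:M) *m ctr H.

Definition p_ap_cond (Nr Nt : nat) (Es : R) (F : 'M[C]_(Nr, Nt))
  (G : 'M[C]_Nt) (y : 'cV[C]_Nr) (x : 'cV[C]_Nt) : R :=
  expR (2 * complex.Re (sc (ctr y *m F *m x))
        - complex.Re (sc (ctr x *m G *m x))
        + complex.Re (sc (ctr x *m x)) / Es).

Definition p_ap (Nr Nt : nat) (Es : R) (F : 'M[C]_(Nr, Nt))
  (G : 'M[C]_Nt) (y : 'cV[C]_Nr) : R :=
  intCn (fun x => p_ap_cond Es F G y x * cgauss Es x).

Definition E_YX (Nr Nt : nat) (Es N0 : R) (H : 'M[C]_(Nr, Nt))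
  (g : 'cV[C]_Nr -> 'cV[C]_Nt -> R) : R :=
  intCn (fun x : 'cV[C]_Nt => intCn (fun z : 'cV[C]_Nr =>
    cgauss Es x * cgauss N0 z * g (H *m x + z) x)).

Definition E_Y (Nr Nt : nat) (Es N0 : R) (H : 'M[C]_(Nr, Nt))
  (h : 'cV[C]_Nr -> R) : R :=
  E_YX Es N0 H (fun y _ => h y).

Definition I_LB_AWLD (Nr nu mu : nat) (Es N0 : R)
  (H : 'M[C]_(Nr, nu + mu)) (La : 'M[C]_(nu + mu)) : R :=
  let Lap := L_ap La in
  let G := ctr Lap *m Lap in
  let F := ctr (W_MMSE (N0 / Es) H) *m G in
  E_YX Es N0 H (fun y x => ln (p_ap_cond Es F G y x))
  - E_Y Es N0 H (fun y => ln (p_ap Es F G y)).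

End AWLD.

(* Main.v *)
(* Write u = W_MMSE y and G = Lap^dagger Lap.  Completing the square,
     log p_ap(y|x) = u^dagger G u - (x - u)^dagger G (x - u) + |x|^2 / Es,
   so p_ap(y) is a Gaussian integral and
     log p_ap(y) = - Nt log Es - log det G + u^dagger G u.
   Hence the rate is Nt log Es + log det G plus
   E|x|^2 / Es - E[(x - u)^dagger G (x - u)].  The first of these terms is Nt.
   The second is tr (G V), where V = (La^dagger La)^-1 is the error covariance
   of the MMSE estimate u, so it equals tr (Wap^dagger Wap), which is also Nt
   because Sigma_a normalises the rows of Sigma_a S^-1. *)
Require Import Defs.
From HB Require Import structures.
From mathcomp Require Import all_boot all_order all_algebra.
From mathcomp Require Import all_classical all_reals all_analysis.
From mathcomp Require Import measurable_realfun complex spectral ring lra.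

Set Implicit Arguments. Unset Strict Implicit. Unset Printing Implicit Defensive.
Import Order.TTheory GRing.Theory Num.Theory.
Import numFieldNormedType.Exports.
Local Open Scope classical_set_scope.
Local Open Scope ring_scope.

(** * Gaussian moments on the real line *)

Section GaussianMoments.
Variable R : realType.
Local Notation mu := (@lebesgue_measure R).
Implicit Types r p x : R.

Lemma eq_RintegralT (f g : R -> R) : f =1 g ->
  Rintegral mu setT f = Rintegral mu setT g.
Proof. by move=> fg; apply: eq_Rintegral => x _. Qed.

Definition egauss r x : R := expR (- (r * x ^+ 2)).

(** With mean [- p] and variance [1 / (2 r)], the peak of the normal density is the inverse of
    [sqrt (pi / r)]. Integrability and total mass then come from the normal law. *)
Lemma egauss_normal r p : 0 < r ->
  (fun x => egauss r (x + p)) =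
  (fun x => Num.sqrt (pi / r) * normal_pdf (- p) (Num.sqrt (2 * r)^-1) x).
Proof.
move=> r0; have r2 : 0 < (2 * r)^-1 by rewrite invr_gt0 mulr_gt0.
have s0 : Num.sqrt (2 * r)^-1 != 0 by rewrite gt_eqF// sqrtr_gt0.
apply/funext => x; rewrite normal_pdfE// /normal_peak /normal_fun.
rewrite sqr_sqrtr ?ltW// opprK.
have -> : (2 * r)^-1 * pi *+ 2 = pi / r by field; rewrite gt_eqF.
rewrite mulrA divff ?mul1r; last first.
  by rewrite gt_eqF// sqrtr_gt0 divr_gt0// pi_gt0.
by congr expR; field; rewrite gt_eqF.
Qed.

Lemma integrable_egauss r p : 0 < r ->
  mu.-integrable setT (EFin \o (fun x => egauss r (x + p))).
Proof.
move=> r0; rewrite egauss_normal//.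
have := @integrable_normal_pdf R (- p) (Num.sqrt (2 * r)^-1).
by move/(integrableZl measurableT (Num.sqrt (pi / r))).
Qed.

Lemma Rintegral_egauss r p : 0 < r ->
  Rintegral mu setT (fun x => egauss r (x + p)) = Num.sqrt (pi / r).
Proof.
move=> r0; rewrite egauss_normal// RintegralZl//; last exact: integrable_normal_pdf.
by rewrite /Rintegral integral_normal_pdf/= mulr1.
Qed.

Lemma continuous_egauss r : continuous (egauss r).
Proof.
move=> x; apply: (cvg_comp _ expR); last exact: continuous_expR.
apply: (@cvgN _ R^o); apply: cvgM; first exact: cvg_cst.
exact: sqr_continuous.
Qed.

(** Half of the exponent absorbs the growth of [f]; the other half, [egauss (r / 2)], is an
    integrable bound. *)
Lemma integrable_poly_egauss r k (f : R -> R) : 0 < r -> continuous f ->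
  (forall x, `|f x| <= k * expR (r / 2 * x ^+ 2)) ->
  mu.-integrable setT (EFin \o (fun x => f x * egauss r x)).
Proof.
move=> r0 cf fk.
apply: (@le_integrable _ _ _ mu _ measurableT _
  (EFin \o (fun x => k * egauss (r / 2) (x + 0)))).
- apply/measurable_EFinP; apply: continuous_measurable_fun => x.
  by apply: cvgM; [exact: cf|exact: continuous_egauss].
- move=> x _; rewrite /= lee_fin addr0 normrM (ger0_norm (expR_ge0 _)).
  apply: le_trans (ler_norm _); apply: le_trans (ler_wpM2r (expR_ge0 _) (fk x)) _.
  have e : expR (r / 2 * x ^+ 2) * egauss r x = egauss (r / 2) x.
    by rewrite /egauss -expRD; congr expR; field.
  by rewrite -e mulrA.
- have r20 : 0 < r / 2 by rewrite divr_gt0.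
  by have /(integrableZl measurableT k) := integrable_egauss 0 r20.
Qed.

Lemma sqr_le_expR r x : 0 < r -> x ^+ 2 <= 2 / r * expR (r / 2 * x ^+ 2).
Proof.
move=> r0; rewrite -ler_pdivrMl ?divr_gt0// invf_div.
by apply: le_trans (expR_ge1Dx _); rewrite lerDr.
Qed.

Lemma integrable_id_egauss r : 0 < r ->
  mu.-integrable setT (EFin \o (fun x => x * egauss r x)).
Proof.
(* The constant reflects [|x| <= 1 + x^2]: the exponential [expR (r / 2 * x ^+ 2)] bounds 1, and
   [2 / r] times it bounds [x^2]. *)
move=> r0; apply: (@integrable_poly_egauss _ (1 + 2 / r)) => //.
  by move=> x; exact: cvg_id.
move=> x; have := sqr_le_expR x r0.
have : 1 <= expR (r / 2 * x ^+ 2).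
  by rewrite -expR0 ler_expR mulr_ge0 ?sqr_ge0// divr_ge0// ltW.
rewrite -real_normK ?num_real//; move: (`|x|) (expR _) => t e e1 te.
rewrite mulrDl mul1r; nra.
Qed.

Lemma integrable_sqr_egauss r : 0 < r ->
  mu.-integrable setT (EFin \o (fun x => x ^+ 2 * egauss r x)).
Proof.
move=> r0; apply: (@integrable_poly_egauss _ (2 / r)) => //.
  by move=> x; exact: sqr_continuous.
by move=> x; rewrite ger0_norm ?sqr_ge0// sqr_le_expR.
Qed.

Lemma Rintegral_id_egauss r : 0 < r ->
  Rintegral mu setT (fun x => x * egauss r x) = 0.
Proof.
move=> r0.
have int A : measurable A -> mu.-integrable A (EFin \o (fun x => x * egauss r x)).
  by move=> mA; apply: integrableS (integrable_id_egauss r0).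
have -> : [set: R] = `]-oo, 0] `|` `]0, +oo[.
  apply/seteqP; split => x//= _; rewrite !in_itv/= andbT.
  by case: (leP x 0); [left|right].
have dj : [disjoint `]-oo, (0 : R)]%classic & `]0, +oo[%classic].
  apply/disj_setPS => x/= []; rewrite !in_itv/= andbT => x0 x1.
  by have := le_lt_trans x0 x1; rewrite ltxx.
rewrite Rintegral_setU//; last by apply: int; exact: measurableU.
(* The integrand is odd. On the negative half-line its sign is flipped first, because the reflection
   [x -> - x] is applied to a nonnegative integrand. *)
rewrite [X in X + _](_ : _ =
    - Rintegral mu `]-oo, 0] (fun x => - x * egauss r x)); last first.
  rewrite -mulN1r -RintegralZl//; last first.
    have /integrableN := int `]-oo, 0]%classic (measurable_itv _).
    by apply: eq_integrable => // x _ /=; rewrite mulNr EFinN.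
  by apply: eq_Rintegral => x _; rewrite mulN1r mulNr opprK.
apply/eqP; rewrite addrC subr_eq0; apply/eqP; congr fine.
have := @ge0_integration_by_substitutionNy R (fun x => - x * egauss r x) 0.
rewrite oppr0 => ->.
- rewrite integral_itv_obnd_cbnd; last first.
    by apply: (measurable_int mu); exact: int.
  by apply: eq_integral => x _/=; rewrite opprK /egauss sqrrN.
- apply: continuous_subspaceT => x; apply: cvgM; last exact: continuous_egauss.
  exact: (@cvgN _ R^o).
- move=> x; rewrite in_itv/= => x0.
  by rewrite mulr_ge0 ?expR_ge0// oppr_ge0 ltW.
Qed.

Lemma Rintegral_sqr_egauss r : 0 < r ->
  Rintegral mu setT (fun x => x ^+ 2 * egauss r x) =
  Num.sqrt (pi / r) / (2 * r).
Proof.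
move=> r0.
(* [(2 r x^2 - 1) exp (- r x^2)] is the derivative of [- x exp (- r x^2)] but
   changes sign; the constant [C] is large enough for adding [C exp (- x)] to
   make it nonnegative on the half-line, as the fundamental theorem of calculus
   on an unbounded interval requires. *)
pose C := expR (1 + (2 * r)^-1).
pose h x := (2 * r * x ^+ 2 - 1) * egauss r x + C * expR (- x).
pose H x := - (x * egauss r x) - C * expR (- x).
have dH x : is_derive x (1 : R) H (h x).
  have d1 : is_derive x (1 : R) (egauss r) (- (2 * r * x) * egauss r x).
    have d2 : is_derive x (1 : R) (fun x => - (r * x ^+ 2)) (- (2 * r * x)).
      apply: is_derive_eq; rewrite /GRing.scale/=; ring.
    have d := @is_derive1_comp R expR (fun x => - (r * x ^+ 2)) x _ _
      (is_derive_expR (- (r * x ^+ 2))) d2.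
    by refine (eq_rect _ (is_derive x 1 (egauss r)) d _ _); rewrite mulrC.
  have d3 : is_derive x (1 : R) (fun x => expR (- x)) (- expR (- x)).
    have d := @is_derive1_comp R expR -%R x _ _ (is_derive_expR _) (is_deriveNid x 1).
    by refine (eq_rect _ (is_derive x 1 (expR \o -%R)) d _ _); rewrite mulrN1.
  have d4 := is_deriveB (is_deriveN (is_deriveM (is_derive_id x (1 : R)) d1))
    (is_deriveZ C d3).
  refine (eq_rect _ (is_derive x 1 H) d4 _ _).
  rewrite /h /GRing.scale/=; ring.
(* If [2 r x^2 >= 1], both summands are nonnegative. Otherwise the negative part is at most 1 in
   modulus, and [x^2 <= 1 / (2 r)] gives [x <= 1 + 1 / (2 r)], whence [C * expR (- x) >= 1]. *)
have h0 x : 0 <= x -> 0 <= h x.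
  move=> x0; rewrite /h addrC -lerBlDr sub0r -mulNr opprB.
  have [x1|x1] := leP 1 (2 * r * x ^+ 2).
    apply: (@le_trans _ _ 0); last by rewrite mulr_ge0 ?expR_ge0.
    by rewrite mulr_le0_ge0 ?expR_ge0// subr_le0.
  apply: (@le_trans _ _ 1).
    rewrite -[leRHS]mulr1; apply: ler_pM.
    - by rewrite subr_ge0 ltW.
    - exact: expR_ge0.
    - by rewrite gerBl mulr_ge0 ?sqr_ge0// mulr_ge0// ltW.
    - by rewrite -expR0 ler_expR oppr_le0 mulr_ge0 ?sqr_ge0 ?ltW.
  rewrite -expRD -[leLHS]expR0 ler_expR.
  have : x ^+ 2 <= (2 * r)^-1.
    by rewrite -[leRHS]mul1r ler_pdivlMr ?mulr_gt0// mulrC ltW.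
  by move: (_^-1) => y; nra.
have cf : continuous h.
  have c1 : continuous (fun x : R => 2 * r * x ^+ 2 - 1).
    move=> x; apply: (@continuousB R R^o R (fun x => 2 * r * x ^+ 2) (cst 1)).
      by apply: continuousM; [exact: cst_continuous|exact: sqr_continuous].
    exact: cst_continuous.
  have c2 : continuous (fun x : R => expR (- x)).
    move=> x; apply: (cvg_comp _ expR); last exact: continuous_expR.
    exact: (@cvgN _ R^o).
  move=> x; apply: (@continuousD R R^o R (fun x => (2 * r * x ^+ 2 - 1) * egauss r x)
    (fun x => C * expR (- x))); apply: continuousM.
  - exact: c1.
  - exact: continuous_egauss.
  - exact: cst_continuous.
  - exact: c2.
have intH : (\int[mu]_(x in `[0%R, +oo[) (h x)%:E = (0 - H 0)%:E)%E.
  apply: ge0_continuous_FTC2y.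
  - by move=> x x0; exact: h0.
  - exact: continuous_subspaceT.
  - rewrite -[X in _ --> X]subr0 -[X in _ --> X - _]oppr0.
    apply: (@cvgB _ R^o); last first.
      by rewrite -(mulr0 C); apply: cvgM; [exact: cvg_cst|exact: cvgr_expR].
    apply: (@cvgN _ R^o).
    (* The upper bound follows from [r x^2 <= expR (r x^2)], a weakening of [1 + t <= expR t]. *)
    apply: (@squeeze_cvgr _ _ _ _ (fun=> 0) (fun x => r^-1 * x^-1)); last 2 first.
    + exact: cvg_cst.
    + rewrite -(mulr0 r^-1); apply: cvgM; first exact: cvg_cst.
      by apply/(@gtr0_cvgV0 R _ _ _ id) => //; exact: nbhs_pinfty_gt.
    near=> x.
    have x0 : 0 < x by near: x; exact: nbhs_pinfty_gt.
    rewrite mulr_ge0 ?expR_ge0 ?(ltW x0)//=.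
    rewrite /egauss expRN -invfM ler_pdivrMr ?expR_gt0//.
    rewrite -ler_pdivrMl ?invr_gt0 ?mulr_gt0// invrK.
    apply: le_trans (expR_ge1Dx _).
    by rewrite -mulrA -expr2 lerDr.
  - by move=> x _; have [] := dH x.
  - apply/cvg_at_right_filter/differentiable_continuous/derivable1_diffP.
    by have [] := dH 0.
  - by move=> x _; rewrite derive1E; have [_ ->] := dH x.
have cexp : continuous (fun x : R => C * expR (- x)).
  move=> x; apply: (@continuousM R R (cst C) (fun x => expR (- x))).
    exact: cst_continuous.
  apply: (cvg_comp _ expR); last exact: continuous_expR.
  exact: (@cvgN _ R^o).
have intE : (\int[mu]_(x in `[0%R, +oo[) (C * expR (- x))%:E = (0 - H 0)%:E)%E.
  pose E (x : R) := - (C * expR (- x)).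
  have -> : 0 - H 0 = 0 - E 0 by rewrite /H /E; ring.
  have dE x : is_derive x (1 : R) E (C * expR (- x)).
    have d := @is_derive1_comp R expR -%R x _ _ (is_derive_expR _) (is_deriveNid x 1).
    have d' := is_deriveN (is_deriveZ C d).
    refine (eq_rect _ (is_derive x 1 E) d' _ _).
    by rewrite /GRing.scale/=; ring.
  rewrite EFinB; apply: (@ge0_continuous_FTC2y R _ E).
  - by move=> x _; rewrite mulr_ge0 ?expR_ge0.
  - exact: continuous_subspaceT.
  - rewrite -[X in _ --> X]oppr0; apply: (@cvgN _ R^o).
    by rewrite -(mulr0 C); apply: cvgM; [exact: cvg_cst|exact: cvgr_expR].
  - by move=> x _; have [] := dE x.
  - apply/cvg_at_right_filter/differentiable_continuous/derivable1_diffP.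
    by have [] := dE 0.
  - by move=> x _; rewrite derive1E; have [_ ->] := dE x.
pose g x := 2 * r * (x ^+ 2 * egauss r x).
have cg : continuous g.
  move=> x; apply: (@continuousM R R (cst (2 * r)) (fun x => x ^+ 2 * egauss r x)).
    exact: cst_continuous.
  apply: (@continuousM R R (fun x => x ^+ 2) (egauss r)).
    exact: sqr_continuous.
  exact: continuous_egauss.
have g0 x : 0 <= g x.
  by rewrite /g mulr_ge0// mulr_ge0 ?sqr_ge0 ?expR_ge0 ?(ltW r0).
have mf (A : set R) (f : R -> R) : continuous f -> measurable_fun A (EFin \o f).
  move=> cf'; apply/measurable_EFinP; apply: measurable_funTS.
  exact: continuous_measurable_fun.
have half : (\int[mu]_(x in `[0%R, +oo[) (g x)%:E =
             \int[mu]_(x in `[0%R, +oo[) (egauss r x)%:E)%E.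
  (* The finite value [0 - H 0] is added to both sides, read through [intE] on the left and [intH]
     on the right. The two integrands then agree, since [g x + C * expR (- x) = h x + egauss r x],
     and every term is nonnegative. *)
  rewrite -[LHS](@addeK _ (0 - H 0)%:E)// -[RHS](@addeK _ (0 - H 0)%:E)//.
  congr (_ - _)%E; rewrite addeC [RHS]addeC.
  have D (f1 f2 : R -> R) : continuous f1 -> continuous f2 ->
      (forall x, 0 <= x -> 0 <= f1 x) -> (forall x, 0 <= x -> 0 <= f2 x) ->
      (\int[mu]_(x in `[0%R, +oo[) (f1 x)%:E + \int[mu]_(x in `[0%R, +oo[) (f2 x)%:E =
       \int[mu]_(x in `[0%R, +oo[) (f1 x + f2 x)%:E)%E.
    move=> c1 c2 p1 p2; rewrite -ge0_integralD//=.
    - by move=> x; rewrite in_itv/= andbT => x0; rewrite lee_fin p1.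
    - exact: mf.
    - by move=> x; rewrite in_itv/= andbT => x0; rewrite lee_fin p2.
    - exact: mf.
  rewrite -[in LHS]intE -[in RHS]intH D//; last by move=> x _; rewrite mulr_ge0 ?expR_ge0.
  rewrite D//.
  - apply: eq_integral => x _; rewrite /h /g; congr EFin; ring.
  - exact: continuous_egauss.
  - by move=> x _; exact: expR_ge0.
have full : (\int[mu]_x (g x)%:E = \int[mu]_x (egauss r x)%:E)%E.
  have c0 : [set x : R | 0 <= x] = `[0, +oo[%classic.
    by apply/seteqP; split => x/=; rewrite in_itv/= andbT.
  rewrite !ge0_symfun_integralT// ?c0 ?half//.
  - by move=> x; rewrite /= /g /egauss sqrrN.
  - by move=> x; exact: expR_ge0.
  - exact: continuous_egauss.
  - by move=> x; rewrite /= /egauss sqrrN.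
have <- : Rintegral mu setT g = Num.sqrt (pi / r).
  rewrite -(Rintegral_egauss 0 r0) {1}/Rintegral full.
  by congr fine; apply: eq_integral => x _; rewrite addr0.
rewrite RintegralZl//; last exact: integrable_sqr_egauss.
by rewrite mulrAC divff ?mul1r// gt_eqF// mulr_gt0.
Unshelve. all: by end_near. Qed.

(** * Quadratic polynomials against a Gaussian, in one real and one complex variable *)

Lemma integrable_quad_egauss r k b a : 0 < r ->
  mu.-integrable setT (EFin \o (fun x => (k + b * x + a * x ^+ 2) * egauss r x)).
Proof.
move=> r0.
have i0 : mu.-integrable setT (EFin \o (fun x => egauss r x)).
  by have := integrable_egauss 0 r0; apply: eq_integrable => // x _; rewrite /= addr0.
have := integrableD measurableT (integrableD measurableT
  (integrableZl measurableT k i0)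
  (integrableZl measurableT b (integrable_id_egauss r0)))
  (integrableZl measurableT a (integrable_sqr_egauss r0)).
apply: eq_integrable => // x _ /=; rewrite -!EFinM -!EFinD; congr EFin; ring.
Qed.

Lemma Rintegral_quad_egauss r k b a : 0 < r ->
  Rintegral mu setT (fun x => (k + b * x + a * x ^+ 2) * egauss r x) =
  Num.sqrt (pi / r) * (k + a / (2 * r)).
Proof.
move=> r0.
have i0 : mu.-integrable setT (EFin \o (fun x => egauss r x)).
  by have := integrable_egauss 0 r0; apply: eq_integrable => // x _; rewrite /= addr0.
have e0 : Rintegral mu setT (egauss r) = Num.sqrt (pi / r).
  by rewrite -(Rintegral_egauss 0 r0); apply: eq_RintegralT => x; rewrite addr0.
have := @integrable_quad_egauss r k b 0 r0.
rewrite (eq_RintegralT (g := fun x => (k + b * x + 0 * x ^+ 2) * egauss r x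
    + a * (x ^+ 2 * egauss r x))); last by move=> x; ring.
move=> i1; rewrite RintegralD//; last first.
  by have := integrableZl measurableT a (integrable_sqr_egauss r0).
have i2 := integrableZl measurableT k i0.
have i3 := integrableZl measurableT b (integrable_id_egauss r0).
rewrite (eq_RintegralT (g := fun x => k * egauss r x + b * (x * egauss r x))); last first.
  by move=> x; ring.
rewrite RintegralD// !RintegralZl//.
1: by rewrite e0 Rintegral_id_egauss// Rintegral_sqr_egauss//; ring.
all: first [exact: integrable_id_egauss|exact: integrable_sqr_egauss].
Qed.

(** This is one complex coordinate of the iterated integral; the shift [(p, q)] accommodates an
    affine term, and the two factors [sqrt (pi / r)] multiply to [pi / r]. *)
Lemma Rintegral2_egauss r (K p q : R) : 0 < r ->
  Rintegral mu setT (fun x => Rintegral mu setT (fun y =>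
    K * expR (- (r * ((x + p) ^+ 2 + (y + q) ^+ 2))))) = K * (pi / r).
Proof.
move=> r0; have pr : 0 <= pi / r by rewrite divr_ge0 ?pi_ge0 ?ltW.
rewrite (eq_RintegralT (g := fun x => K * Num.sqrt (pi / r) * egauss r (x + p))).
  rewrite RintegralZl//; last exact: integrable_egauss.
  by rewrite Rintegral_egauss// -mulrA -expr2 sqr_sqrtr.
move=> x; rewrite (eq_RintegralT (g := fun y => K * egauss r (x + p) * egauss r (y + q))).
  rewrite RintegralZl//; last exact: integrable_egauss.
  by rewrite Rintegral_egauss// mulrAC.
by move=> y; rewrite -mulrA /egauss -expRD mulrDr opprD.
Qed.

(** The linear terms vanish by oddness, and each of the two squares contributes [a / (2 r)]. *)
Lemma Rintegral2_quad_egauss r (K k b c a : R) : 0 < r ->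
  Rintegral mu setT (fun x => Rintegral mu setT (fun y =>
    K * expR (- (r * (x ^+ 2 + y ^+ 2))) *
      (k + b * x + c * y + a * (x ^+ 2 + y ^+ 2)))) =
  K * (pi / r) * (k + a / r).
Proof.
move=> r0; have pr : 0 <= pi / r by rewrite divr_ge0 ?pi_ge0 ?ltW.
pose q := Num.sqrt (pi / r).
rewrite (eq_RintegralT (g := fun x => K * q *
    ((k + a / (2 * r) + b * x + a * x ^+ 2) * egauss r x))).
  rewrite RintegralZl//; last exact: integrable_quad_egauss.
  rewrite Rintegral_quad_egauss// -/q.
  have -> : K * (pi / r) = K * q * q by rewrite -mulrA -expr2 sqr_sqrtr.
  rewrite -[RHS]mulrA; congr (_ * _).
  by congr (_ * _); rewrite -addrA; congr (_ + _); field; rewrite gt_eqF.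
move=> x; rewrite (eq_RintegralT (g := fun y => K * egauss r x *
    ((k + b * x + a * x ^+ 2 + c * y + a * y ^+ 2) * egauss r y))).
  rewrite RintegralZl//; last exact: integrable_quad_egauss.
  by rewrite Rintegral_quad_egauss// -/q; ring.
by move=> y; rewrite (mulrDr r) opprD expRD /egauss; ring.
Qed.

End GaussianMoments.

(** * Iterated Gaussian integrals *)

Section IteratedComplex.
Variable R : realType.
Local Notation mu := (@lebesgue_measure R).
Local Notation C := R[i].
Local Notation Re := complex.Re.
Local Notation Im := complex.Im.
Implicit Types (z w : C) (n : nat).

Definition nsq z : R := Re z ^+ 2 + Im z ^+ 2.

Lemma conjE (a b : R) : (Complex a b : C)^* = Complex a (- b).
Proof. by []. Qed.

Lemma ReD z w : Re (z + w) = Re z + Re w.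
Proof. by case: z; case: w. Qed.

Lemma ReN z : Re (- z) = - Re z.
Proof. by case: z. Qed.

Lemma ReB z w : Re (z - w) = Re z - Re w.
Proof. by rewrite ReD ReN. Qed.

Lemma Re_sum n (f : 'I_n -> C) : Re (\sum_i f i) = \sum_i Re (f i).
Proof.
by elim/big_ind2: _ => // _ x _ y <- <-; rewrite ReD.
Qed.

Lemma ReJ z : Re z^* = Re z.
Proof. by case: z. Qed.

Lemma nsqM z w : nsq (z * w) = nsq z * nsq w.
Proof. by case: z => a b; case: w => c d; rewrite /nsq /=; ring. Qed.

Lemma nsq_gt0 z : z != 0 -> 0 < nsq z.
Proof.
case: z => a b z0; rewrite lt_neqAle eq_sym addr_ge0 ?sqr_ge0// andbT.
rewrite /nsq /= paddr_eq0 ?sqr_ge0// !sqrf_eq0.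
by apply: contra z0 => /andP[/eqP -> /eqP ->].
Qed.

Lemma conj_mul_nsq z : z^* * z = (nsq z)%:C%C.
Proof.
by case: z => a b; rewrite conjE; apply/eqP; rewrite eq_complex /nsq/=;
  apply/andP; split; apply/eqP; ring.
Qed.

Lemma eq_iintC n (f g : (nat -> C) -> R) : f =1 g -> iintC n f = iintC n g.
Proof. by move=> fg; congr iintC; apply/funext. Qed.

(* Coordinate [0] is integrated innermost, so for an upper triangular [U] every
   integration only shifts the affine terms [d] of the rows that remain; the
   factor [K] collects what has been integrated out. *)
Lemma iintC_gauss n (U : nat -> nat -> C) :
  (forall i j, (j < i)%N -> U i j = 0) -> (forall i, (i < n)%N -> U i i != 0) ->
  forall (K : R) (d : nat -> C),
  iintC n (fun g => K * expR (- \sum_(i < n) nsq (\sum_(j < n) U i j * g j + d i)))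
  = K * \prod_(i < n) (pi / nsq (U i i)).
Proof.
move=> Utri; elim: n => [|n IH] U0 K d.
  by rewrite /= !big_ord0 oppr0 expR0.
have u0 := U0 n (ltnSn n); have s0 := nsq_gt0 u0.
(* The last row involves only the outermost coordinate [c]. Since [u * c + d n = u * (c + w)], its
   affine term is a translation by [w]. *)
set u := U n n in u0 s0; pose w := d n / u.
rewrite /= big_ord_recr /= mulrA.
rewrite -(Rintegral2_egauss _ (Re w) (Im w) s0).
apply: eq_RintegralT => x; apply: eq_RintegralT => y.
set c := Complex x y.
transitivity (iintC n (fun g => K * expR (- nsq (u * c + d n)) *
    expR (- \sum_(i < n) nsq (\sum_(j < n) U i j * g j + (U i n * c + d i))))).
  apply: eq_iintC => g; rewrite -mulrA -expRD -opprD; congr (_ * expR (- _)).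
  rewrite big_ord_recr /= addrC; congr (_ + _).
    rewrite big_ord_recr /= eqxx big1 ?add0r// => j _.
    by rewrite Utri ?mul0r.
  apply: eq_bigr => i _; rewrite big_ord_recr /= eqxx addrA; congr (nsq (_ + _ + _)).
  by apply: eq_bigr => j _; rewrite ltn_eqF.
rewrite (IH _ _ (fun i => U i n * c + d i)); last by move=> i /ltnW; exact: U0.
rewrite mulrAC; congr (_ * expR (- _)).
have -> : u * c + d n = u * (c + w) by rewrite mulrDr /w mulrCA divff// mulr1.
by rewrite nsqM /nsq; case: (w).
Qed.

(** With the outermost coordinate [c] fixed, the cross terms of the quadratic form become linear in
    the other coordinates: under the real part, [(g i)^* * a i n * c] may be replaced by
    [(a i n * c)^* * g i]. Hence [b] and [k] must be arbitrary for the induction. Linear terms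
    integrate to 0, so only the diagonal of [a] survives. *)
Lemma iintC_quad n r : 0 < r ->
  forall (K k : R) (b : nat -> C) (a : nat -> nat -> C),
  iintC n (fun g => K * expR (- (r * \sum_(i < n) nsq (g i))) *
    (k + Re (\sum_(i < n) b i * g i)
       + Re (\sum_(i < n) \sum_(j < n) (g i)^* * a i j * g j)))
  = K * (pi / r) ^+ n * (k + Re (\sum_(i < n) a i i) / r).
Proof.
move=> r0; elim: n => [|n IH] K k b a.
  by rewrite /= !big_ord0 mulr0 oppr0 expR0 /= mul0r !addr0 expr0.
rewrite [RHS](_ : _ = K * (pi / r) ^+ n * (pi / r) *
    (k + Re (\sum_(i < n) a i i) / r + Re (a n n) / r)); last first.
  by rewrite exprSr big_ord_recr /= ReD; ring.
rewrite -(Rintegral2_quad_egauss _ _ (Re (b n)) (- Im (b n)) (Re (a n n)) r0).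
apply: eq_RintegralT => x; apply: eq_RintegralT => y.
set c := Complex x y.
transitivity (iintC n (fun g => K * expR (- (r * nsq c)) *
    expR (- (r * \sum_(i < n) nsq (g i))) *
    (k + Re (b n * c) + Re (c^* * a n n * c) +
     Re (\sum_(i < n) (b i + (a i n * c)^* + c^* * a n i) * g i)
       + Re (\sum_(i < n) \sum_(j < n) (g i)^* * a i j * g j)))).
  apply: eq_iintC => g; rewrite -[in RHS](mulrA K) -expRD -opprD -mulrDr.
  congr (_ * expR (- (_ * _)) * _).
    rewrite big_ord_recr /= eqxx addrC; congr (_ + _).
    by apply: eq_bigr => i _; rewrite ltn_eqF.
  rewrite !big_ord_recr /= eqxx !ReD.
  under eq_bigr => i _ do rewrite ltn_eqF//.
  under [X in _ + (Re X + _)]eq_bigr => i _ do rewrite big_ord_recr /= eqxx ltn_eqF//.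
  have e1 : Re (\sum_(i < n) (\sum_(j < n) (g i)^* * a i j *
      (if j == n :> nat then c else g j) + (g i)^* * a i n * c)) =
      Re (\sum_(i < n) \sum_(j < n) (g i)^* * a i j * g j) +
      Re (\sum_(i < n) (a i n * c)^* * g i).
    rewrite big_split /= ReD; congr (Re _ + _).
      by apply: eq_bigr => i _; apply: eq_bigr => j _; rewrite ltn_eqF.
    rewrite !Re_sum; apply: eq_bigr => i _.
    by rewrite /c; case: (g i) (a i n) => g1 g2 [a1 a2]; rewrite rmorphM !conjE /=; ring.
  have e2 : \sum_(i < n) c^* * a n i * (if i == n :> nat then c else g i) =
      \sum_(i < n) c^* * a n i * g i.
    by apply: eq_bigr => i _; rewrite ltn_eqF.
  rewrite e1 e2; under [in RHS]eq_bigr do rewrite !mulrDl.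
  rewrite !big_split /= !ReD; ring.
rewrite (IH _ _ (fun i => b i + (a i n * c)^* + c^* * a n i)) /nsq /=.
by rewrite /c; case: (b n) (a n n) => b1 b2 [a1 a2]; rewrite conjE /=; ring.
Qed.

End IteratedComplex.

(** * Gaussian integrals of Hermitian forms *)

Section HermitianForms.
Variable R : realType.
Local Notation C := R[i].
Local Notation Re := complex.Re.

Lemma ctrE m n (A : 'M[C]_(m, n)) : ctr A = map_mx Num.conj A^T.
Proof. by apply/matrixP => i j; rewrite !mxE. Qed.

Lemma ctrM m n p (A : 'M[C]_(m, n)) (B : 'M[C]_(n, p)) :
  ctr (A *m B) = ctr B *m ctr A.
Proof. by rewrite !ctrE trmx_mul map_mxM. Qed.

Lemma ctrD m n (A B : 'M[C]_(m, n)) : ctr (A + B) = ctr A + ctr B.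
Proof. by rewrite !ctrE linearD /= map_mxD. Qed.

Lemma ctrN m n (A : 'M[C]_(m, n)) : ctr (- A) = - ctr A.
Proof. by rewrite !ctrE linearN /= map_mxN. Qed.

Lemma ctrK m n (A : 'M[C]_(m, n)) : ctr (ctr A) = A.
Proof. by apply/matrixP => i j; rewrite !mxE conjCK. Qed.

Lemma ctr1 n : ctr 1%:M = 1%:M :> 'M[C]_n.
Proof. by rewrite ctrE trmx1 map_mx1. Qed.

Lemma ctr_inv n (A : 'M[C]_n) : ctr (invmx A) = invmx (ctr A).
Proof. by rewrite !ctrE trmx_inv map_invmx. Qed.

Lemma det_ctr n (A : 'M[C]_n) : \det (ctr A) = (\det A)^*.
Proof. by rewrite ctrE det_map_mx det_tr. Qed.

Lemma sc_mul n (b : 'rV[C]_n) (v : 'cV[C]_n) :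
  sc (b *m v) = \sum_i b ord0 i * v i ord0.
Proof. by rewrite /sc mxE. Qed.

Lemma sc_form m n (u : 'cV[C]_m) (A : 'M[C]_(m, n)) (v : 'cV[C]_n) :
  sc (ctr u *m A *m v) = \sum_i \sum_j (u i ord0)^* * A i j * v j ord0.
Proof.
rewrite sc_mul exchange_big; apply: eq_bigr => j _.
by rewrite mxE mulr_suml; apply: eq_bigr => i _; rewrite mxE.
Qed.

Lemma scD (a b : 'M[C]_1) : sc (a + b) = sc a + sc b.
Proof. by rewrite /sc mxE. Qed.

Lemma sc0 : sc (0 : 'M[C]_1) = 0.
Proof. by rewrite /sc mxE. Qed.

Lemma scN (a : 'M[C]_1) : sc (- a) = - sc a.
Proof. by rewrite /sc mxE. Qed.

Lemma Re_sc_ctr (a : 'M[C]_1) : Re (sc (ctr a)) = Re (sc a).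
Proof. by rewrite /sc mxE ReJ. Qed.

Lemma Re_sc_sqr n (v : 'cV[C]_n) : Re (sc (ctr v *m v)) = \sum_i nsq (v i ord0).
Proof.
rewrite sc_mul Re_sum; apply: eq_bigr => i _.
by rewrite mxE conj_mul_nsq.
Qed.

(** Taking the real part allows the two arguments to be exchanged at the price of an adjoint
    ([rformC]), so that conjugate cross terms merge. *)
Definition rform m n (u : 'cV[C]_m) (A : 'M[C]_(m, n)) (v : 'cV[C]_n) : R :=
  Re (sc (ctr u *m A *m v)).

Lemma rformDl m n (u u' : 'cV[C]_m) (A : 'M[C]_(m, n)) v :
  rform (u + u') A v = rform u A v + rform u' A v.
Proof. by rewrite /rform ctrD !mulmxDl scD ReD. Qed.

Lemma rformDr m n u (A : 'M[C]_(m, n)) v v' :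
  rform u A (v + v') = rform u A v + rform u A v'.
Proof. by rewrite /rform mulmxDr scD ReD. Qed.

Lemma rformDm m n u (A A' : 'M[C]_(m, n)) v :
  rform u (A + A') v = rform u A v + rform u A' v.
Proof. by rewrite /rform mulmxDr mulmxDl scD ReD. Qed.

Lemma rformMl m n p (P : 'M[C]_(p, m)) u (A : 'M[C]_(p, n)) v :
  rform (P *m u) A v = rform u (ctr P *m A) v.
Proof. by rewrite /rform ctrM !mulmxA. Qed.

Lemma rformMr m n p (P : 'M[C]_(n, p)) u (A : 'M[C]_(m, n)) v :
  rform u A (P *m v) = rform u (A *m P) v.
Proof. by rewrite /rform !mulmxA. Qed.

Lemma rformC m n u (A : 'M[C]_(m, n)) v : rform u A v = rform v (ctr A) u.
Proof. by rewrite /rform -Re_sc_ctr !ctrM ctrK mulmxA. Qed.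

Lemma rform1 n (u v : 'cV[C]_n) : Re (sc (ctr u *m v)) = rform u 1%:M v.
Proof. by rewrite /rform mulmx1. Qed.

(** This passes from ordinal indices of matrices to the natural-number indices of [iintC]. The
    default 0 keeps the extension of a triangular matrix triangular. *)
Definition natext n (f : 'I_n -> C) (i : nat) : C :=
  if insub i is Some j then f j else 0.

Lemma natextE n (f : 'I_n -> C) (i : 'I_n) : natext f i = f i.
Proof. by rewrite /natext valK. Qed.

(** For triangular [U], the product of the squared moduli of the diagonal entries is [|det U|^2],
    the determinant of the Gram matrix. *)
Lemma intCn_gauss n (U : 'M[C]_n) (K : R) (d : 'cV[C]_n) :
  (forall i j : 'I_n, (j < i)%N -> U i j = 0) -> U \in unitmx ->
  intCn (fun v => K * expR (- Re (sc (ctr (U *m v + d) *m (U *m v + d)))))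
  = K * (pi ^+ n / Re (\det (ctr U *m U))).
Proof.
move=> Utri Uunit.
have detU : \det U = \prod_i U i i.
  rewrite -det_tr det_trig; first by apply: eq_bigr => i _; rewrite mxE.
  by apply/is_trig_mxP => i j ij; rewrite mxE Utri.
have U0 i : U i i != 0.
  by move: Uunit; rewrite unitmxE unitfE detU => /prodf_neq0/(_ i); exact.
pose V i j := natext (fun i => natext (fun j => U i j) j) i.
have VE (i j : 'I_n) : V i j = U i j by rewrite /V !natextE.
rewrite /intCn.
transitivity (iintC n (fun g => K * expR (- \sum_(i < n)
    nsq (\sum_(j < n) V i j * g j + natext (fun i => d i ord0) i)))).
  apply: eq_iintC => g; congr (_ * expR (- _)); rewrite Re_sc_sqr.
  apply: eq_bigr => i _; rewrite mxE natextE mxE; congr (nsq (_ + _)).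
  by apply: eq_bigr => j _; rewrite mxE VE.
rewrite iintC_gauss.
- rewrite det_mulmx det_ctr conj_mul_nsq /= detU prodf_div prodr_const card_ord.
  congr (_ * (_ / _)); rewrite (big_morph (@nsq R) (@nsqM R) (_ : nsq 1 = 1)).
    by apply: eq_bigr => i _; rewrite VE.
  by rewrite /nsq /= expr1n expr0n addr0.
- move=> i j ji; rewrite /V /natext; case: insubP => // i' _ ii'.
  by case: insubP => // j' _ jj'; apply: Utri; rewrite ii' jj'.
- by move=> i ni; have := U0 (Ordinal ni); rewrite -VE.
Qed.

(** These are the moments of a centred circular Gaussian vector with covariance [s] times the
    identity: mean zero removes [b], and the covariance yields the trace. *)
Lemma intCn_quad n (s K k : R) (b : 'rV[C]_n) (A : 'M[C]_n) : 0 < s ->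
  intCn (fun v => K * cgauss s v *
    (k + Re (sc (b *m v)) + rform v A v))
  = K * (k + s * Re (\tr A)).
Proof.
move=> s0; rewrite /intCn.
pose V i j := natext (fun i => natext (fun j => A i j) j) i.
have VE (i j : 'I_n) : V i j = A i j by rewrite /V !natextE.
transitivity (iintC n (fun g => K * (pi * s) ^- n *
    expR (- (s^-1 * \sum_(i < n) nsq (g i))) *
    (k + Re (\sum_(i < n) natext (fun i => b ord0 i) i * g i)
       + Re (\sum_(i < n) \sum_(j < n) (g i)^* * V i j * g j)))).
  apply: eq_iintC => g; rewrite /cgauss mulrA mulNr mulrC [in RHS]mulrC.
  congr ((_ + Re _ + Re _) * (_ * expR (- _))).
  - by rewrite sc_mul; apply: eq_bigr => i _; rewrite mxE natextE.
  - rewrite /rform sc_form; apply: eq_bigr => i _; apply: eq_bigr => j _.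
    by rewrite !mxE VE.
  - rewrite mulrC Re_sc_sqr; congr (_ * _).
    by apply: eq_bigr => i _; rewrite mxE.
rewrite iintC_quad ?invr_gt0// invrK -(mulrA K) mulVf ?mulr1; last first.
  by rewrite expf_neq0// gt_eqF// mulr_gt0// pi_gt0.
congr (_ * (_ + _)); rewrite mulrC; congr (_ * Re _).
by apply: eq_bigr => i _; rewrite VE.
Qed.

Lemma E_YX_quad Nr Nt (Es N0 k : R) (H : 'M[C]_(Nr, Nt)) (M : 'M[C]_Nr)
    (B : 'M[C]_(Nr, Nt)) (D : 'M[C]_Nt) : 0 < Es -> 0 < N0 ->
  E_YX Es N0 H (fun y x => k + rform y M y + rform y B x + rform x D x)
  = k + N0 * Re (\tr M) + Es * Re (\tr (ctr H *m M *m H + ctr H *m B + D)).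
Proof.
move=> Es0 N00; rewrite /E_YX.
(* With [y = H x + z], this is the form in [x] left after averaging over the noise. *)
set A := ctr H *m M *m H + ctr H *m B + D.
rewrite -[RHS]mul1r -(@intCn_quad _ _ _ _ 0)//; congr intCn; apply/funext => x.
rewrite mul0mx sc0 addr0.
transitivity (cgauss Es x * (k + rform x A x + N0 * Re (\tr M))).
  (* For fixed [x], the terms linear in [z] are gathered into one functional. As [M] is an arbitrary
     square matrix, the two cross terms of [rform y M y] enter through [M] and [ctr M]
     separately. *)
  rewrite -(@intCn_quad _ _ _ _
    (ctr (ctr M *m (H *m x) + M *m (H *m x) + B *m x)))//.
  congr intCn; apply/funext => z; congr (_ * _).
  rewrite rform1 !rformDl !rformDr !(rformMl, rformMr) mulmx1 !rformDm.
  rewrite !(rformC z _ x) !ctrM !ctrK -!mulmxA !mulmx1.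
  move: (rform x (ctr H *m (M *m H)) x) (rform x (ctr H *m M) z)
    (rform x (ctr H *m ctr M) z) (rform x (ctr H *m B) x) (rform x (ctr B) z)
    (rform x D x) (rform z M z) => *; ring.
by rewrite mul1r addrAC.
Qed.

(** This is a QR factorisation: it supplies the upper triangular matrix that [intCn_gauss] requires,
    with the same Gram matrix. Gram-Schmidt on the rows of [ctr A] gives a unitary [Q] such that row
    [j] of [ctr A] lies in the span of the rows of [Q] up to [j]. It is thus orthogonal to row [i]
    of [Q] for [j < i], which says that [Q *m A] is upper triangular. *)
Lemma upper_factor n (A : 'M[C]_n) : A \in unitmx ->
  exists U : 'M[C]_n, [/\ forall i j : 'I_n, (j < i)%N -> U i j = 0,
    U \in unitmx & ctr U *m U = ctr A *m A].
Proof.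
move=> Aunit; pose Q := schmidt (ctr A).
have /unitarymxP : Q \is unitarymx by exact: schmidt_unitarymx.
move=> QQ0; have QQ : Q *m ctr Q = 1%:M.
  rewrite -QQ0; apply/matrixP => i j; rewrite !mxE.
  by apply: eq_bigr => k _; rewrite !mxE.
have QQ' := mulmx1C QQ.
exists (Q *m A); split.
- move=> i j ji.
  have : (row j (ctr A) <= kermx (ctr (row i Q)))%MS.
    apply: submx_trans (row_schmidt_sub _ _) _.
    apply/sumsmx_subP => k kj; rewrite genmxE; apply/sub_kermxP/matrixP => a b.
    have ki : (k == i) = false by apply/negbTE/eqP => ki; move: kj; rewrite ki leqNgt ji.
    move/matrixP : QQ => /(_ k i); rewrite !mxE ki mulr0n => e; rewrite -[RHS]e.
    by apply: eq_bigr => l _; rewrite !mxE.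
  move/sub_kermxP/matrixP/(_ ord0 ord0).
  rewrite !mxE => e; apply/eqP; rewrite -conjC_eq0 rmorph_sum -[X in _ == X]e.
  by apply/eqP; apply: eq_bigr => l _; rewrite !mxE rmorphM mulrC.
- by rewrite unitmx_mul Aunit andbT; case/mulmx1_unit: QQ.
- by rewrite ctrM mulmxA -(mulmxA (ctr A)) QQ' mulmx1.
Qed.

End HermitianForms.

(** * The achievable rate *)

Section Rate.
Variable R : realType.
Local Notation C := R[i].
Local Notation Re := complex.Re.

Lemma rformN m n u (A : 'M[C]_(m, n)) v : rform u (- A) v = - rform u A v.
Proof. by rewrite /rform mulmxN mulNmx scN ReN. Qed.

Lemma rformNr m n u (A : 'M[C]_(m, n)) v : rform u A (- v) = - rform u A v.
Proof. by rewrite /rform mulmxN scN ReN. Qed.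

Lemma rformNl m n u (A : 'M[C]_(m, n)) v : rform (- u) A v = - rform u A v.
Proof. by rewrite /rform ctrN !mulNmx scN ReN. Qed.

Lemma rform0 m n u v : rform u (0 : 'M[C]_(m, n)) v = 0.
Proof. by rewrite /rform mulmx0 mul0mx sc0. Qed.

Lemma rformZ m n a u (A : 'M[C]_(m, n)) v :
  rform u (RC a *: A) v = a * rform u A v.
Proof.
rewrite /rform -scalemxAr -scalemxAl /sc mxE.
by case: (_ ord0 ord0) => x y /=; rewrite mul0r subr0.
Qed.

Lemma Re_RCM (a : R) (z : C) : Re (RC a * z) = a * Re z.
Proof. by case: z => x y /=; rewrite mul0r subr0. Qed.

Lemma RCM (a b : R) : RC (a * b) = RC a * RC b.
Proof. exact: (rmorphM (real_complex R)). Qed.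

Lemma conj_RC (a : R) : (RC a)^* = RC a.
Proof. by rewrite /RC conjE oppr0. Qed.

Lemma RC_neq0 (a : R) : 0 < a -> RC a != 0.
Proof. by move=> a0; rewrite eq_complex /= gt_eqF. Qed.

Lemma ctrZ m n (a : R) (A : 'M[C]_(m, n)) : ctr (RC a *: A) = RC a *: ctr A.
Proof. by apply/matrixP => i j; rewrite !mxE rmorphM; congr (_ * _); exact: conj_RC. Qed.

Lemma Re_det_gram_gt0 n (L : 'M[C]_n) : L \in unitmx ->
  0 < Re (\det (ctr L *m L)).
Proof.
rewrite unitmxE unitfE => L0.
by rewrite det_mulmx det_ctr conj_mul_nsq /= nsq_gt0.
Qed.

(** The term [|x|^2 / Es] of the model cancels the exponent of the prior density, leaving a Gaussian
    in [x] centred at [u = W y] with form [G]. The powers of [pi] cancel as well. *)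
Lemma ln_p_ap Nr Nt (Es : R) (W : 'M[C]_(Nt, Nr)) (L : 'M[C]_Nt) y :
  0 < Es -> L \in unitmx ->
  let G := ctr L *m L in
  ln (p_ap Es (ctr W *m G) G y) =
  - (Nt%:R * ln Es) - ln (Re (\det G)) + rform y (ctr W *m G *m W) y.
Proof.
move=> Es0 Lunit G; have [U [Utri Uunit UG]] := upper_factor Lunit.
have G0 := Re_det_gram_gt0 Lunit; rewrite -/G in UG G0.
pose u := W *m y.
have GC : ctr G = G by rewrite ctrM ctrK.
have -> : rform y (ctr W *m G *m W) y = rform u G u.
  by rewrite /u rformMl rformMr mulmxA.
have -> : p_ap Es (ctr W *m G) G y =
    (pi * Es) ^- Nt * expR (rform u G u) * (pi ^+ Nt / Re (\det G)).
  rewrite -UG -(intCn_gauss _ (U *m (- u)) Utri Uunit) UG.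
  congr intCn; apply/funext => x.
  rewrite /p_ap_cond /cgauss mulrCA -expRD -[RHS]mulrA -expRD.
  congr (_ * expR _).
  have -> : Re (sc (ctr (U *m x + U *m - u) *m (U *m x + U *m - u))) =
      rform x G x - rform u G x *+ 2 + rform u G u.
    rewrite -mulmxDr rform1 rformMl rformMr mulmx1 UG.
    rewrite rformDl !rformDr !(rformNl, rformNr) (rformC x G u) GC.
    move: (rform u G x) (rform x G x) (rform u G u) => *; ring.
  rewrite -!/(rform _ _ _) -rformMl -/u.
  move: (rform u G x) (rform x G x) (rform u G u) (Re _) => *; ring.
have E : (pi * Es) ^- Nt * expR (rform u G u) * (pi ^+ Nt / Re (\det G)) =
    expR (rform u G u) * ((Es ^+ Nt)^-1 * (Re (\det G))^-1).
  rewrite exprMn; field.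
  by rewrite !expf_neq0 ?gt_eqF ?pi_gt0.
rewrite E lnM ?posrE ?expR_gt0 ?mulr_gt0 ?invr_gt0 ?exprn_gt0//.
rewrite expRK lnM ?posrE ?invr_gt0 ?exprn_gt0// !lnV ?posrE ?exprn_gt0//.
by rewrite lnXn// mulr_natl addrC.
Qed.

(** * Invertibility and row normalisation of [W_ap] *)

Lemma lower_pos_unitmx n (L : 'M[C]_n) :
  (forall i j : 'I_n, (i < j)%N -> L i j = 0) -> (forall i, 0 < L i i) ->
  L \in unitmx.
Proof.
move=> L0 Lp; rewrite unitmxE unitfE det_trig; last exact/is_trig_mxP.
by apply/prodf_neq0 => i _; rewrite gt_eqF.
Qed.

Lemma gram_diag n (A : 'M[C]_n) i :
  (A *m ctr A) i i = RC (\sum_j nsq (A i j)).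
Proof.
rewrite mxE [RC _](rmorph_sum (real_complex R)); apply: eq_bigr => j _.
by rewrite mxE mulrC conj_mul_nsq.
Qed.

(** A vanishing diagonal entry would make row [i] of [A] zero, contradicting [A *m invmx A = 1].
    This positivity makes the inverse square roots in [Sigma_a] meaningful. *)
Lemma gram_diag_gt0 n (A : 'M[C]_n) i : A \in unitmx -> 0 < (A *m ctr A) i i.
Proof.
move=> Aunit; rewrite gram_diag ltcE /= eqxx /= lt_neqAle eq_sym.
have nsq0 j : 0 <= nsq (A i j) by rewrite addr_ge0 ?sqr_ge0.
rewrite sumr_ge0 ?andbT; last by move=> j _.
rewrite psumr_eq0; last by move=> j _.
apply/negP => /allP A0.
have : (A *m invmx A) i i = 0.
  rewrite mxE big1// => j _; suff -> : A i j = 0 by rewrite mul0r.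
  apply/eqP; apply: contraTT (A0 j (mem_index_enum j)) => /nsq_gt0 Aij.
  by rewrite gt_eqF.
by rewrite mulmxV// mxE eqxx => /eqP; rewrite oner_eq0.
Qed.

Lemma diag_gram n (d : 'rV[C]_n) (A : 'M[C]_n) i :
  (diag_mx d *m A *m ctr (diag_mx d *m A)) i i =
  d ord0 i * (A *m ctr A) i i * (d ord0 i)^*.
Proof.
rewrite !gram_diag [RHS]mulrAC (mulrC (d ord0 i)) conj_mul_nsq -[RHS]RCM.
rewrite mulr_sumr; congr RC; apply: eq_bigr => j _.
by rewrite mul_diag_mx mxE nsqM.
Qed.

(** By cyclicity the trace is that of [B *m ctr B], whose diagonal entries are [D i i] divided by
    the square of its root, hence 1. *)
Lemma trace_Sigma_a n (S : 'M[C]_n) : S \in unitmx ->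
  let B := Sigma_a S *m invmx S in B \in unitmx /\ \tr (ctr B *m B) = n%:R.
Proof.
move=> Sunit B; set D := invmx S *m ctr (invmx S).
have D0 i : 0 < D i i by rewrite gram_diag_gt0// unitmx_inv.
have dE i : Defs.mxdiag D i i = D i i by rewrite /Defs.mxdiag !mxE eqxx mulr1n.
have s0 i : 0 < sqrtC (D i i) by rewrite sqrtC_gt0.
split.
  rewrite unitmx_mul unitmx_inv Sunit andbT unitmxE unitfE det_diag.
  by apply/prodf_neq0 => i _; rewrite mxE dE invr_neq0// gt_eqF.
rewrite mxtrace_mulC -[RHS]/(n%:R) -[n in RHS]card_ord -sumr_const.
apply: eq_bigr => i _; rewrite diag_gram mxE dE -/D.
rewrite geC0_conj ?invr_ge0 ?ltW// -[X in _ * X * _]sqrtCK expr2.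
by field; rewrite gt_eqF.
Qed.

Lemma trace_W_ap nu mu (L : 'M[C]_(nu + mu)) : drsubmx L \in unitmx ->
  W_ap L \in unitmx /\ \tr (ctr (W_ap L) *m W_ap L) = (nu + mu)%:R.
Proof.
move=> /trace_Sigma_a; rewrite /W_ap; set B := Sigma_a _ *m _ => -[Bunit Btr].
split.
  by rewrite unitmxE det_lblock det1 mul1r -unitmxE.
have -> : ctr (block_mx 1%:M 0 0 B) = block_mx 1%:M 0 0 (ctr B) :> 'M[C]_(nu + mu).
  rewrite !ctrE tr_block_mx map_block_mx !trmx0 !map_mx0.
  by rewrite trmx1 map_mx1.
rewrite mulmx_block !(mul0mx, mulmx0, add0r, addr0, mulmx1).
by rewrite mxtrace_block mxtrace1 Btr natrD.
Qed.

(** * The weighted error of the MMSE estimate *)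

Lemma trace_rotate m n (A : 'M[C]_(m, n)) (G : 'M[C]_n) (B : 'M[C]_(n, m)) :
  \tr (A *m G *m B) = \tr (G *m (B *m A)).
Proof. by rewrite -mulmxA mxtrace_mulC mulmxA. Qed.

Lemma mxtrace_BZ n (a : C) (G A B : 'M[C]_n) :
  \tr (G *m (A - a *: B)) = \tr (G *m A) - a * \tr (G *m B).
Proof. by rewrite mulmxBr -scalemxAr raddfB /= mxtraceZ. Qed.

(** The left side is the trace of [G] times the error covariance [N0 W W^dagger + Es (1 - W H) (1 -
    W H)^dagger]. With [T = H^dagger H + a], one has [1 - W H = a T^-1] and
    [W W^dagger = (1 - a T^-1) T^-1], so this covariance is [N0 T^-1], the inverse of
    [La^dagger La]. *)
Lemma mmse_trace Nr n (Es N0 : R) (H : 'M[C]_(Nr, n)) (La Wp : 'M[C]_n) :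
  0 < Es -> 0 < N0 -> La \in unitmx ->
  RC N0 *: (ctr La *m La) = ctr H *m H + (RC (N0 / Es))%:M ->
  let W := W_MMSE (N0 / Es) H in
  let G := ctr (Wp *m La) *m (Wp *m La) in
  RC N0 * \tr (ctr W *m G *m W)
    + RC Es * (\tr (ctr H *m (ctr W *m G *m W) *m H)
    - \tr (ctr H *m (ctr W *m G)) *+ 2 + \tr G)
  = \tr (ctr Wp *m Wp).
Proof.
move=> Es0 N00 Launit; set X := ctr H *m H; set a := RC (N0 / Es) => TE W G.
set T := X + a%:M in TE.
(* This relation makes the terms in [T^-2] cancel at the end. *)
have zE : RC N0 = RC Es * a by rewrite -RCM mulrCA divff ?mulr1// gt_eqF.
have ctrT : ctr T = T by rewrite -TE ctrZ ctrM ctrK.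
have ctrLaunit : ctr La \in unitmx.
  by rewrite unitmxE det_ctr unitfE conjC_eq0 -unitfE -unitmxE.
have Tunit : T \in unitmx.
  by rewrite -TE unitmxZ ?unitmx_mul ?ctrLaunit// unitfE RC_neq0.
have XTi : X *m invmx T = 1%:M - a *: invmx T.
  have -> : X = T - a%:M by rewrite /T addrK.
  by rewrite mulmxBl mulmxV// mul_scalar_mx.
have TiX : invmx T *m X = 1%:M - a *: invmx T.
  have -> : X = T - a%:M by rewrite /T addrK.
  by rewrite mulmxBr mulVmx// mul_mx_scalar.
have WE : W = invmx T *m ctr H by [].
have GE : G = ctr (Wp *m La) *m (Wp *m La) by [].
clearbody W G.
have ctrWE : ctr W = H *m invmx T by rewrite WE ctrM ctrK ctr_inv ctrT.
have -> : \tr (ctr H *m (ctr W *m G *m W) *m H) =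
    \tr (G *m (invmx T *m X *m (X *m invmx T))).
  rewrite (_ : ctr H *m _ *m H = (ctr H *m ctr W) *m G *m (W *m H)).
    by rewrite trace_rotate ctrWE WE /X !mulmxA.
  by rewrite !mulmxA.
have -> : \tr (ctr H *m (ctr W *m G)) = \tr (G *m (X *m invmx T)).
  by rewrite mulmxA mxtrace_mulC ctrWE /X !mulmxA.
have -> : \tr (ctr W *m G *m W) = \tr (G *m (invmx T *m X *m invmx T)).
  by rewrite trace_rotate ctrWE WE /X !mulmxA.
rewrite TiX XTi.
have -> : \tr (ctr Wp *m Wp) = RC N0 * \tr (G *m invmx T).
  (* A right inverse of a square matrix is also a left inverse, so the rotated product
     [(N0 La T^-1) (La^dagger)] is the identity and [La] disappears from the trace. *)
  have i1 : ctr La *m (RC N0 *: (La *m invmx T)) = 1%:M.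
    by rewrite -scalemxAr mulmxA scalemxAl TE mulmxV.
  rewrite -mxtraceZ scalemxAr GE ctrM.
  rewrite [X in _ = \tr X](_ : _ =
      ctr La *m (ctr Wp *m Wp) *m (RC N0 *: (La *m invmx T))).
    by rewrite trace_rotate (mulmx1C i1) mulmx1.
  by rewrite -!scalemxAr !mulmxA.
have tr1 : \tr (G *m (1%:M - a *: invmx T)) = \tr G - a * \tr (G *m invmx T).
  by rewrite mxtrace_BZ mulmx1.
have tr2 : \tr (G *m ((1%:M - a *: invmx T) *m invmx T)) =
    \tr (G *m invmx T) - a * \tr (G *m (invmx T *m invmx T)).
  by rewrite mulmxBl mul1mx -scalemxAl mxtrace_BZ.
have tr3 : \tr (G *m ((1%:M - a *: invmx T) *m (1%:M - a *: invmx T))) =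
    \tr G - a * \tr (G *m invmx T) -
    a * (\tr (G *m invmx T) - a * \tr (G *m (invmx T *m invmx T))).
  by rewrite mulmxBr mulmx1 -scalemxAr mxtrace_BZ tr1 tr2.
rewrite tr1 tr2 tr3 zE.
move: (\tr G) (\tr (G *m invmx T)) (\tr (G *m (invmx T *m invmx T))) => *; ring.
Qed.

End Rate.

(** * The augmented channel and the evaluation of the rate *)

Lemma augH_gram (R : realType) Nr Nt (N0 Es : R) (H : 'M[R[i]]_(Nr, Nt)) :
  0 < N0 -> 0 < Es -> ctr (augH N0 Es H) *m augH N0 Es H =
  RC N0^-1 *: (ctr H *m H) + RC Es^-1 *: 1%:M.
Proof.
move=> N00 Es0; rewrite /augH [ctr _]ctrE tr_col_mx map_row_mx mul_row_col.
rewrite -!ctrE !ctrZ ctr1 -!scalemxAl -!scalemxAr !scalerA -!RCM mulmx1.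
by rewrite -!expr2 !exprVn !sqr_sqrtr ?ltW.
Qed.

(* N_t = nu + mu with 1 <= nu <= N_t - 1, i.e. mu >= 1; N_r >= N_t. *)
Theorem theorem2 (R : realType) (Nr nu mu : nat)
  (hnu : (1 <= nu)%N) (hmu : (1 <= mu)%N) (hNr : (nu + mu <= Nr)%N)
  (H : 'M[R[i]]_(Nr, nu + mu)) (Es N0 : R) (hEs : 0 < Es) (hN0 : 0 < N0)
  (Qa : 'M[R[i]]_(Nr + (nu + mu), nu + mu)) (La : 'M[R[i]]_(nu + mu))
  (hQL : thinQL (augH N0 Es H) Qa La) :
  I_LB_AWLD Es N0 H La
  = (nu + mu)%:R * ln Es
    + ln (complex.Re (\det (ctr (L_ap La) *m L_ap La))).
Proof.
case: hQL => QQ Ltri Lpos HQL.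
have Launit := lower_pos_unitmx Ltri Lpos.
have Sunit : drsubmx La \in unitmx.
  apply: lower_pos_unitmx => [i j ij|i]; rewrite !mxE; last exact: Lpos.
  by apply: Ltri; rewrite ltn_add2l.
have [Wunit Wtr] := trace_W_ap Sunit.
have Lunit : L_ap La \in unitmx by rewrite unitmx_mul Wunit.
(* Orthonormality of the columns of [Qa] identifies the Gram matrices of [La] and of the augmented
   channel; scaled by [N0], this is the matrix inverted in [W_MMSE]. *)
have TE : RC N0 *: (ctr La *m La) = ctr H *m H + (RC (N0 / Es))%:M.
  have -> : ctr La *m La = ctr (augH N0 Es H) *m augH N0 Es H.
    by rewrite HQL ctrM mulmxA -(mulmxA (ctr La)) QQ mulmx1.
  rewrite augH_gram// scalerDr !scalerA -!RCM divff ?gt_eqF//.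
  by rewrite [RC 1](_ : _ = 1)// scale1r scalemx1.
have trE := mmse_trace (W_ap La) hEs hN0 Launit TE.
rewrite Wtr -/(L_ap La) /= in trE.
rewrite /I_LB_AWLD /=.
set G := ctr (L_ap La) *m L_ap La in trE *.
set W := W_MMSE _ H in trE *.
have GE : forall y, ln (p_ap Es (ctr W *m G) G y) =
    - ((nu + mu)%:R * ln Es) - ln (complex.Re (\det G)) + rform y (ctr W *m G *m W) y.
  by move=> y; exact: ln_p_ap.
clearbody G W.
(* Both log-densities are put into the shape of [E_YX_quad]: here there is no form in [y] alone, and
   the factor 2 becomes a repeated summand. *)
have -> : E_YX Es N0 H (fun y x => ln (p_ap_cond Es (ctr W *m G) G y x)) =
    E_YX Es N0 H (fun y x => 0 + rform y 0 y +
      rform y (ctr W *m G + ctr W *m G) x + rform x (RC Es^-1 *: 1%:M - G) x).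
  congr E_YX; apply/funext => y; apply/funext => x.
  rewrite /p_ap_cond expRK rform0 !rformDm rformN rformZ -rform1.
  rewrite -!/(rform _ _ _).
  move: (rform y _ x) (rform x G x) (complex.Re _) => *; ring.
have -> : E_Y Es N0 H (fun y => ln (p_ap Es (ctr W *m G) G y)) =
    E_YX Es N0 H (fun y x => - ((nu + mu)%:R * ln Es) - ln (complex.Re (\det G)) +
      rform y (ctr W *m G *m W) y + rform y 0 x + rform x 0 x).
  rewrite /E_Y; congr E_YX; apply/funext => y; apply/funext => x.
  by rewrite GE !rform0 !addr0.
rewrite !E_YX_quad//.
rewrite !(mulmx0, mul0mx, add0r, addr0) mxtrace0 mulr0 add0r.
have ReN_nat n : complex.Re (n%:R : R[i]) = n%:R.
  by rewrite -(rmorph_nat (real_complex R)).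
have := congr1 (@complex.Re R) trE.
rewrite ReD !Re_RCM ReD ReB mulr2n ReD ReN_nat.
rewrite mulmxDr !mxtraceD [\tr (- G)]raddfN mxtraceZ mxtrace1 /= !ReD ReN Re_RCM ReN_nat.
move: (complex.Re (\tr _)) (complex.Re (\tr _)) (complex.Re (\tr _))
  (complex.Re (\tr _)) (complex.Re (\det _)) => t c b g d e.
(* This is the mean of [|x|^2 / Es]; it cancels the weighted error, which equals the same number by
   [e]. *)
have n1 : Es * (Es^-1 * (nu + mu)%:R) = (nu + mu)%:R by rewrite mulVKf ?gt_eqF.
rewrite !(mulrDr, mulrN) n1 -e; ring.
Qed.
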